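(* Let $A \in \mathbb{C}_{n,m}$ and $D, E \in \mathbb{C}_{m,n}$. The following statements are equivalent. (i) The matrix $A$ is right $(D,E)$-invertible. (ii) $\mathcal{R}(E)=\mathcal{R}(EAD)$. (iii) $\mathrm{rk}(E)=\mathrm{rk}(EAD)$. (iv) $\dim\mathcal{N}(E)=\dim\mathcal{N}(EAD)$. (v) $\mathbb{C}^n=\mathcal{R}(AD) + \mathcal{N}(E)$. (vi) $\mathbb{C}^m=\mathcal{R}(D) + \mathcal{N}(EA)$ and $\mathrm{rk}(EA)=\mathrm{rk}(E)$.
   Context: $\mathbb{C}_{m,n}$ is the set of $m\times n$ complex matrices ($m,n\in\mathbb{N}$). For a matrix $M\in\mathbb{C}_{p,q}$, $\mathcal{R}(M)=\{M\mathbf{x}:\mathbf{x}\in\mathbb{C}^q\}$ is its column space, $\mathcal{N}(M)=\{\mathbf{x}\in\mathbb{C}^q: M\mathbf{x}=\mathbf{0}\}$ its null space, and $\mathrm{rk}(M)$ its rank. For $A \in \mathbb{C}_{n,m}$ and $D, E \in \mathbb{C}_{m,n}$, $A$ is right $(D,E)$-invertible if there exists $B\in\mathbb{C}_{m,n}$ such that $EAB=E$ and $\mathcal{R}(B)\subseteq\mathcal{R}(D)$; such a $B$ is called a right $(D,E)$-inverse of $A$. *)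

(* Defs.v *)
From mathcomp Require Import all_boot all_order all_algebra.
From mathcomp Require Import reals.
From mathcomp.real_closed Require Import complex.

Set Implicit Arguments.
Unset Strict Implicit.
Unset Printing Implicit Defensive.

Import GRing.Theory.
Local Open Scope ring_scope.

(* For R : realType, R[i] is the field of complex numbers.  A p x q matrix    *)
(* acts on column vectors by left multiplication (the row-space operations of *)
(* mxalgebra act on the other side), so its range and null space are          *)
(* subspaces of 'cV_p and 'cV_q.                                              *)

Definition colspace (R : realType) (p q : nat) (M : 'M[R[i]]_(p, q)) :
    {vspace 'cV[R[i]]_p} :=
  limg (linfun (mulmx M : 'cV[R[i]]_q -> 'cV[R[i]]_p)).

Definition nullspace (R : realType) (p q : nat) (M : 'M[R[i]]_(p, q)) :
    {vspace 'cV[R[i]]_q} :=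
  lker (linfun (mulmx M : 'cV[R[i]]_q -> 'cV[R[i]]_p)).

Lemma colspaceP (R : realType) (p q : nat) (M : 'M[R[i]]_(p, q))
    (y : 'cV[R[i]]_p) :
  reflect (exists x : 'cV[R[i]]_q, y = M *m x) (y \in colspace M).
Proof.
apply: (iffP memv_imgP) => [[x _ ->]|[x ->]]; exists x; rewrite ?lfunE //.
by rewrite memvf.
Qed.

Lemma nullspaceP (R : realType) (p q : nat) (M : 'M[R[i]]_(p, q))
    (x : 'cV[R[i]]_q) :
  reflect (M *m x = 0) (x \in nullspace M).
Proof. by rewrite memv_ker lfunE; exact: eqP. Qed.

Definition right_inverse_along (R : realType) (n m : nat)
    (A : 'M[R[i]]_(n, m)) (D E B : 'M[R[i]]_(m, n)) : Prop :=
  E *m A *m B = E /\ (colspace B <= colspace D)%VS.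

Definition right_invertible_along (R : realType) (n m : nat)
    (A : 'M[R[i]]_(n, m)) (D E : 'M[R[i]]_(m, n)) : Prop :=
  exists B : 'M[R[i]]_(m, n), right_inverse_along A D E B.

(* Main.v *)
Require Import Defs.
From mathcomp Require Import all_boot all_order all_algebra.
From mathcomp Require Import reals.
From mathcomp.real_closed Require Import complex.

(** Every condition says in its own way that [E] and [E *m A *m D] have the
    same column space, that is, that [E] factors as [E *m A *m D *m X].

    The inclusion [colspace (M *m N) <= colspace M] always holds, so equality
    of the two column spaces is already forced by equality of ranks
    ([colspace_mulmx_eq_rank]) or, by rank-nullity ([dim_nullspace]), of
    nullities.  Equality of the column spaces of [M] and [M *m N] is also
    equivalent to [colspace N + nullspace M] being the whole space
    ([fullv_colspace_nullspace]): [M *m x = M *m (N *m y)] means exactly that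
    [x - N *m y] lies in the null space of [M].  Applied to [M = E] and
    [N = A *m D], this turns the equality of ranges into the first
    decomposition; applied to [M = E *m A] and [N = D], it gives the second
    one, where the rank condition compares [E *m A] with [E].  Finally, a
    factorization [E = E *m A *m D *m X] gives the inverse [B = D *m X], and
    conversely every [B] with range inside that of [D] has this form
    ([colspace_subP]). *)

Import GRing.Theory.
Local Open Scope ring_scope.

(** Solving [M = N *m X] amounts to solving it one column of [M] at a time. *)
Lemma colspace_subP (R : realType) (p q r : nat)
    (M : 'M[R[i]]_(p, q)) (N : 'M[R[i]]_(p, r)) :
  (colspace M <= colspace N)%VS <-> exists X : 'M_(r, q), M = N *m X.
Proof.
split=> [/subvP sMN | [X ->]]; last first.
  apply/subvP => _ /colspaceP[x ->]; apply/colspaceP.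
  by exists (X *m x); rewrite mulmxA.
have solve j : exists x : 'cV_r, col j M == N *m x.
  have /sMN/colspaceP[x Mx] : col j M \in colspace M.
    by apply/colspaceP; exists (delta_mx j 0); rewrite colE.
  by exists x; apply/eqP.
exists (\matrix_(i, j) xchoose (solve j) i 0).
apply/matrixP => i j; have /eqP/colP/(_ i) := xchooseP (solve j).
by rewrite !mxE => ->; apply: eq_bigr => k _; rewrite mxE.
Qed.

Lemma colspace_mulmx_sub (R : realType) (p q r : nat)
    (M : 'M[R[i]]_(p, q)) (N : 'M[R[i]]_(q, r)) :
  (colspace (M *m N) <= colspace M)%VS.
Proof. by apply/colspace_subP; exists N. Qed.

(** In the rank factorization [M = col_base M *m row_base M] the right factor
    is right invertible, so [M] and [col_base M] have the same range, and the
    left factor is injective on a space of dimension [\rank M]. *)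
Lemma dim_colspace (R : realType) (p q : nat) (M : 'M[R[i]]_(p, q)) :
  \dim (colspace M) = \rank M.
Proof.
have -> : colspace M = colspace (col_base M).
  apply/eqP; rewrite eqEsubv; apply/andP; split; apply/colspace_subP.
    by exists (row_base M); rewrite mulmx_base.
  have /row_freeP[X baseX] := row_base_free M.
  exists X; rewrite -[LHS]mulmx1 -baseX mulmxA.
  by congr (_ *m X); rewrite mulmx_base.
have /row_fullP[Y Ybase] := col_base_full M.
rewrite /colspace limg_dim_eq; first by rewrite dimvf /dim /= muln1.
apply/eqP; rewrite -subv0; apply/subvP => x /memv_capP[_ /nullspaceP base_x].
by rewrite memv0 -[x]mul1mx -Ybase -mulmxA base_x mulmx0.
Qed.

Lemma dim_nullspace (R : realType) (p q : nat) (M : 'M[R[i]]_(p, q)) :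
  (\dim (nullspace M) + \rank M)%N = q.
Proof.
have := limg_ker_dim (linfun (mulmx M : 'cV[R[i]]_q -> 'cV[R[i]]_p)) fullv.
by rewrite capfv -/(nullspace M) -/(colspace M) dim_colspace dimvf /dim /= muln1.
Qed.

(** One inclusion is automatic, and a subspace of full dimension is
    everything. *)
Lemma colspace_mulmx_eq_rank (R : realType) (p q r : nat)
    (M : 'M[R[i]]_(p, q)) (N : 'M[R[i]]_(q, r)) :
  \rank M = \rank (M *m N) -> colspace M = colspace (M *m N).
Proof.
move=> eq_rk; apply/esym/eqP.
by rewrite eqEdim colspace_mulmx_sub !dim_colspace eq_rk leqnn.
Qed.

(** A preimage [N *m y] of [M *m x] differs from [x] by an element of the
    null space of [M]. *)
Lemma fullv_colspace_nullspace (R : realType) (p q r : nat)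
    (M : 'M[R[i]]_(p, q)) (N : 'M[R[i]]_(q, r)) :
  fullv = (colspace N + nullspace M)%VS <-> colspace M = colspace (M *m N).
Proof.
split=> [full | eqMN].
  apply/eqP; rewrite eqEsubv colspace_mulmx_sub andbT.
  apply/subvP => _ /colspaceP[x ->].
  have: x \in fullv by rewrite memvf.
  rewrite full => /memv_addP[_ /colspaceP[y ->] [z /nullspaceP Mz ->]].
  by apply/colspaceP; exists y; rewrite mulmxDr Mz addr0 mulmxA.
apply/esym/eqP; rewrite eqEsubv subvf; apply/subvP => x _.
have /colspaceP[y Mx] : M *m x \in colspace (M *m N).
  by rewrite -eqMN; apply/colspaceP; exists x.
apply/memv_addP; exists (N *m y); first by apply/colspaceP; exists y.
exists (x - N *m y); last by rewrite addrC subrK.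
by apply/nullspaceP; rewrite mulmxBr Mx mulmxA subrr.
Qed.

Theorem theorem3p1 (R : realType) (n m : nat)
    (A : 'M[R[i]]_(n, m)) (D E : 'M[R[i]]_(m, n)) :
  [<-> right_invertible_along A D E;
       colspace E = colspace (E *m A *m D);
       \rank E = \rank (E *m A *m D);
       \dim (nullspace E) = \dim (nullspace (E *m A *m D));
       fullv = (colspace (A *m D) + nullspace E)%VS;
       fullv = (colspace D + nullspace (E *m A))%VS /\
         \rank (E *m A) = \rank E].
Proof.
tfae.
- case=> B [EAB /colspace_subP[X defB]].
  apply/eqP; rewrite eqEsubv -{2}mulmxA colspace_mulmx_sub andbT.
  by apply/colspace_subP; exists X; rewrite -mulmxA -defB EAB.
- by move=> eq_col; rewrite -!dim_colspace eq_col.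
- move=> eq_rk; apply/eqP; rewrite -(eqn_add2r (\rank E)) {2}eq_rk.
  by rewrite !dim_nullspace.
- move=> eq_null; apply/fullv_colspace_nullspace/colspace_mulmx_eq_rank.
  rewrite mulmxA; apply/eqP; rewrite -(eqn_add2l (\dim (nullspace E))).
  by rewrite {2}eq_null !dim_nullspace.
- move=> /fullv_colspace_nullspace; rewrite mulmxA => eq_col.
  (* The range of E *m A is squeezed between those of E *m A *m D and E. *)
  have eq_EA : colspace (E *m A) = colspace E.
    by apply/eqP; rewrite eqEsubv colspace_mulmx_sub eq_col colspace_mulmx_sub.
  split; first by apply/fullv_colspace_nullspace; rewrite eq_EA.
  by rewrite -!dim_colspace eq_EA.
- case=> /fullv_colspace_nullspace eq_EAD /esym/colspace_mulmx_eq_rank eq_E.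
  have /colspace_subP[X defE] : (colspace E <= colspace (E *m A *m D))%VS.
    by rewrite eq_E eq_EAD.
  exists (D *m X); split; last exact: colspace_mulmx_sub.
  by rewrite mulmxA -defE.
Qed.
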